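(* Let $(\mathcal A,\pi,M,\rho)$ be a convenient anchored bundle, let $\mathbf p:\mathcal E\to M$ be a convenient vector bundle with typical fibre $\mathbb E$, let $\mathcal M\subset\mathcal E$ be an open submanifold such that $\mathbf p|_{\mathcal M}:\mathcal M\to M$ is a surjective fibration with typical fibre an open subset of $\mathbb E$, and let $\mathbf T\mathcal M$ be the prolongation of $(\mathcal A,\pi,M,\rho)$ over $\mathcal M$. Assume that there exists a linear connection on the bundle $\mathbf p:\mathcal E\to M$. Then there exists a connection $\mathbf N$ on $\mathbf T\mathcal M$.
   Context: Everything is in the convenient setting of Kriegl–Michor. A convenient anchored bundle is a convenient vector bundle $\pi:\mathcal A\to M$ with a vector bundle morphism $\rho:\mathcal A\to TM$. Fibration: $M$ is covered by chart domains $U$ over which $\mathcal A$ and $\mathcal E$ are trivial, with $\mathcal E_U\cong U\times\mathbb E$ sending $\mathcal M_U=\mathcal M\cap\mathbf p^{-1}(U)$ onto $U\times\mathbb O$, $\mathbb O\subset\mathbb E$ open. Prolongation: $\mathbf T\mathcal M$ is the convenient vector bundle over $\mathcal M$ with fibre $\mathbf T_m\mathcal M=\{(a,\mu)\in\mathcal A_{\mathbf p(m)}\times T_m\mathcal M:\rho(a)=T\mathbf p(\mu)\}$ at $m$; its vertical subbundle is $\mathbf V\mathcal M=\{(m,a,\mu)\in\mathbf T\mathcal M:a=0\}$. A connection on $\mathcal E$ is a Whitney decomposition $T\mathcal E=H\mathcal E\oplus V\mathcal E$, where $V\mathcal E=\ker T\mathbf p$; it is linear if, in local trivializations of $\mathcal{E}$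 over chart domains of $M$ (model space $\mathbb M$), the horizontal space at $(x,e)$ is $\{(v,-\Gamma_x(v,e)):v\in\mathbb M\}$ with $\Gamma_x$ bounded bilinear $\mathbb M\times\mathbb E\to\mathbb E$ depending smoothly on $x$. A connection on $\mathbf T\mathcal M$ is a decomposition into a Whitney sum of subbundles $\mathbf T\mathcal M=\mathbf H\mathcal M\oplus\mathbf V\mathcal M$; equivalently, an endomorphism $\mathbf N$ of $\mathbf T\mathcal M$ with $\mathbf N^2=\mathrm{Id}$ and $\ker(\mathrm{Id}+\mathbf N)=\mathbf V\mathcal M$ (then $\mathbf H\mathcal M=\ker(\mathrm{Id}-\mathbf N)$). *)

(* Defs.v *)
From HB Require Import structures.
From mathcomp Require Import all_boot all_order all_algebra.
From mathcomp Require Import all_classical reals topology normedtype.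

Set Implicit Arguments.
Unset Strict Implicit.
Unset Printing Implicit Defensive.

Import Order.TTheory GRing.Theory Num.Theory.
Import numFieldNormedType.Exports.

Local Open Scope classical_set_scope.
Local Open Scope ring_scope.

Section Curves.
Context {R : realType}.
Implicit Types E F : tvsType R.

(* Calculus in the sense of Froelicher, Kriegl and Michor.  A curve is smooth
   when all its iterated derivatives exist; the topology that matters is the
   c^oo-topology, final for the smooth curves; a map defined on a c^oo-open set
   is smooth when it carries smooth curves to smooth curves. *)

Definition is_deriv E (c : R -> E) (t : R) (d : E) : Prop :=
  (fun h : R => h^-1 *: (c (t + h) - c t)) @ 0^' --> d.

Definition smooth_curve E (c : R -> E) : Prop :=
  exists d : nat -> R -> E,
    d 0%N = c /\ forall n t, is_deriv (d n) t (d n.+1 t).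

Definition cinf_open E (U : set E) : Prop :=
  forall c : R -> E, smooth_curve c -> open (c @^-1` U).

(* When u is injective on S with c^oo-open image, this says that
   f o (u|_S)^-1 : u(S) -> F is smooth: smooth curves in u(S) are exactly the
   curves u o g with g in S.  For T = E and u = id it is smoothness on S. *)
Definition smooth_along T E F (S : set T) (u : T -> E) (f : T -> F) : Prop :=
  forall g : R -> T, (forall t, S (g t)) ->
    smooth_curve (u \o g) -> smooth_curve (f \o g).

Definition vN_bounded E (B : set E) : Prop :=
  forall U : set E, nbhs 0 U -> exists r : R, B `<=` [set r *: x | x in U].

(* The bounded set B need not be assumed absolutely convex, since the
   absolutely convex hull of a bounded set is bounded. *)
Definition mackey_cauchy E (x : nat -> E) : Prop :=
  exists2 B : set E, vN_bounded B &
  exists mu : nat -> nat -> R,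
    (forall e : R, 0 < e ->
       exists N, forall n m, (N <= n)%N -> (N <= m)%N -> `|mu n m| < e) /\
    (forall n m, exists2 b, B b & x n - x m = mu n m *: b).

(* The derivative of f at x in the direction v; 0 when it does not exist. *)
Definition dirD E F (f : E -> F) (x v : E) : F :=
  xget 0 [set d | is_deriv (fun t : R => f (x + t *: v)) 0 d].

Lemma is_deriv_pair E F (c : R -> E) (d : R -> F) t a b :
  is_deriv c t a -> is_deriv d t b -> is_deriv (fun s => (c s, d s)) t (a, b).
Proof. by move=> ca db; exact: (cvg_pair ca db). Qed.

Lemma is_deriv_fst E F (c : R -> E * F) t a :
  is_deriv c t a -> is_deriv (fst \o c) t a.1.
Proof.
move=> ca; apply: (cvg_comp _ fst ca).
by case: a {ca} => a b; exact: cvg_fst.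
Qed.

Lemma is_deriv_snd E F (c : R -> E * F) t a :
  is_deriv c t a -> is_deriv (snd \o c) t a.2.
Proof.
move=> ca; apply: (cvg_comp _ snd ca).
by case: a {ca} => a b; exact: cvg_snd.
Qed.

Lemma smooth_pair E F (c : R -> E) (d : R -> F) :
  smooth_curve c -> smooth_curve d -> smooth_curve (fun s => (c s, d s)).
Proof.
move=> [c' [<- cP]] [d' [<- dP]]; exists (fun n s => (c' n s, d' n s)).
by split=> // n t; exact: is_deriv_pair.
Qed.

Lemma smooth_fst E F (c : R -> E * F) :
  smooth_curve c -> smooth_curve (fst \o c).
Proof.
move=> [c' [<- cP]]; exists (fun n => fst \o c' n); split=> // n t.
exact: is_deriv_fst.
Qed.

Lemma smooth_snd E F (c : R -> E * F) :
  smooth_curve c -> smooth_curve (snd \o c).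
Proof.
move=> [c' [<- cP]]; exists (fun n => snd \o c' n); split=> // n t.
exact: is_deriv_snd.
Qed.

Lemma is_deriv_line E (x v : E) t : is_deriv (fun s : R => x + s *: v) t v.
Proof.
apply: (@cvg_near_cst _ _ v).
near=> h; have h0 : h != 0 by near: h; exact: nbhs_dnbhs_neq.
apply/eqP; rewrite opprD addrACA subrr add0r -scalerBl addrAC subrr add0r.
by rewrite scalerA mulVf// scale1r.
Unshelve. all: by end_near. Qed.

Lemma is_deriv_cst E (v : E) t : is_deriv (fun _ : R => v) t 0.
Proof.
by apply: (@cvg_near_cst _ _ 0); near=> h; rewrite subrr scaler0.
Unshelve. all: by end_near. Qed.

Lemma smooth_line E (x v : E) : smooth_curve (fun t : R => x + t *: v).
Proof.
exists (fun n => match n with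
  | 0%N => fun t => x + t *: v | 1%N => fun=> v | _ => fun=> 0 end).
split=> // -[|[|n]] t; [exact: is_deriv_line|exact: is_deriv_cst..].
Qed.

End Curves.

HB.mixin Record Tvs_isConvenient (R : realType) E & Tvs R E := {
  convenient_hausdorff : hausdorff_space E ;
  convenient_mackey : forall x : nat -> E, mackey_cauchy x ->
    exists l : E, x @ \oo --> l
}.

#[short(type="convenientType")]
HB.structure Definition Convenient (R : realType) :=
  {E of Tvs R E & Tvs_isConvenient R E}.

Section ProductConvenient.
Context {R : realType} (E F : convenientType R).

Let prod_hausdorff : hausdorff_space (E * F)%type.
Proof.
move=> [a b] [a' b'] ab; congr pair.
- apply: convenient_hausdorff => A B Aa Bb.
  have [] := ab (fst @^-1` A) (fst @^-1` B) (filter_prod1 Aa) (filter_prod1 Bb).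
  by move=> [x y] [/= Ax Bx]; exists x.
- apply: convenient_hausdorff => A B Aa Bb.
  have [] := ab (snd @^-1` A) (snd @^-1` B) (filter_prod2 Aa) (filter_prod2 Bb).
  by move=> [x y] [/= Ax Bx]; exists y.
Qed.

Let prod_mackey (x : nat -> E * F) : mackey_cauchy x ->
  exists l : E * F, x @ \oo --> l.
Proof.
move=> [B Bb [mu [mu0 muB]]].
have [l xl] : exists l : E, (fst \o x) @ \oo --> l.
  apply: (@convenient_mackey R E (fst \o x)); exists (fst @` B).
    move=> U U0; have [r rB] := Bb (fst @^-1` U) (filter_prod1 U0).
    by exists r => _ [b /rB[y Uy <-] <-]; exists y.1.
  exists mu; split=> // n m; have [b Bb' e] := muB n m.
  by exists b.1; [exists b|rewrite -[RHS]/((mu n m *: b).1) -e].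
have [l' xl'] : exists l : F, (snd \o x) @ \oo --> l.
  apply: (@convenient_mackey R F (snd \o x)); exists (snd @` B).
    move=> U U0; have [r rB] := Bb (snd @^-1` U) (filter_prod2 U0).
    by exists r => _ [b /rB[y Uy <-] <-]; exists y.2.
  exists mu; split=> // n m; have [b Bb' e] := muB n m.
  by exists b.2; [exists b|rewrite -[RHS]/((mu n m *: b).2) -e].
exists (l, l'); rewrite (_ : x = fun n => ((fst \o x) n, (snd \o x) n)).
  exact: cvg_pair xl xl'.
by apply/funext => n /=; case: (x n).
Qed.

HB.instance Definition _ :=
  Tvs_isConvenient.Build R (E * F)%type prod_hausdorff prod_mackey.

End ProductConvenient.

Lemma dirD_eq (R : realType) (E : tvsType R) (F : convenientType R)
    (f : E -> F) x v d :
  is_deriv (fun t : R => f (x + t *: v)) 0 d -> dirD f x v = d.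
Proof.
move=> fd; apply: xget_unique => // d' fd'.
exact: (cvg_unique (@convenient_hausdorff _ F) fd' fd).
Qed.

(* Charts take values in c^oo-open subsets of the fixed model space E; no
   separation axiom is imposed on the natural topology.  [chart_at] selects
   a chart around every point: the chart domains cover, and the selected chart
   is the one in which tangent spaces are represented. *)
Record manifold (R : realType) (E : convenientType R) := Manifold {
  point_of :> Type ;
  chart_ix : Type ;
  chart_dom : chart_ix -> set point_of ;
  chart : chart_ix -> point_of -> E ;
  chart_at : point_of -> chart_ix ;
  mem_chart_at : forall x, chart_dom (chart_at x) x ;
  chart_inj : forall i, {in chart_dom i &, injective (chart i)} ;
  chart_open : forall i j,
    cinf_open (chart i @` (chart_dom i `&` chart_dom j)) ;
  chart_change : forall i j,
    smooth_along (chart_dom i `&` chart_dom j) (chart i) (chart j)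
}.
Arguments chart_dom {R E m} _.
Arguments chart {R E m} _ _.
Arguments chart_at {R E m} _.

(* Open for the natural topology of M. *)
Definition mopen (R : realType) (E : convenientType R) (M : manifold E)
  (W : set M) : Prop := forall i, cinf_open (chart i @` (chart_dom i `&` W)).

(* Fibres with their trivializing maps, without axioms; a vector bundle in the
   sense of [is_vector_bundle] is a bundle whose trivializations are linear,
   cover the base and change smoothly.  Tangent bundles and prolongations are
   given below through this record. *)
Record bundle (R : realType) (E : convenientType R) (M : manifold E)
    (F : convenientType R) := Bundle {
  fibre :> M -> lmodType R ;
  triv_ix : Type ;
  triv_dom : triv_ix -> set M ;
  triv : triv_ix -> forall x, fibre x -> F ;
  triv_at : M -> triv_ix
}.
Arguments triv_dom {R E M F b} _.
Arguments triv {R E M F b} _ {x}.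
Arguments triv_at {R E M F b} _.

Definition total (R : realType) (E : convenientType R) (M : manifold E)
  (F : convenientType R) (B : bundle M F) : Type := {x : M & B x}.

Section Bundles.
Context {R : realType} {E : convenientType R} {M : manifold E}
  {F : convenientType R} (B : bundle M F).

Definition over (S : set M) : set (total B) := [set b | S (projT1 b)].

Definition total_coord (i : chart_ix M) (k : triv_ix B) (b : total B) : E * F :=
  (chart i (projT1 b), triv k (projT2 b)).

(* phi is a vector bundle chart of B over the open set U, with fibre G: it is
   linear and bijective on fibres, and smoothly compatible in both directions
   with the given trivializations. *)
Definition local_trivialization (G : convenientType R) (U : set M)
    (phi : forall x, B x -> G) : Prop :=
  [/\ mopen U,
      (forall x, U x -> linear (phi x) /\ bijective (phi x)) &
      forall x, U x -> exists i k, [/\ chart_dom i x, triv_dom k x,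
        smooth_along (over (U `&` chart_dom i `&` triv_dom k))
          (total_coord i k) (fun b => phi _ (projT2 b)) &
        smooth_along (over (U `&` chart_dom i `&` triv_dom k))
          (fun b => (chart i (projT1 b), phi _ (projT2 b)))
          (fun b => triv k (projT2 b))]].

Record is_vector_bundle : Prop := {
  mem_triv_at : forall x, triv_dom (triv_at x : triv_ix B) x ;
  triv_dom_open : forall k : triv_ix B, mopen (triv_dom k) ;
  triv_linear : forall (k : triv_ix B) x, triv_dom k x ->
    linear (@triv _ _ _ _ B k x) ;
  triv_bij : forall (k : triv_ix B) x, triv_dom k x ->
    bijective (@triv _ _ _ _ B k x) ;
  triv_change : forall (i : chart_ix M) (k l : triv_ix B),
    smooth_along (over (chart_dom i `&` triv_dom k `&` triv_dom l))
      (total_coord i k) (fun b => triv l (projT2 b))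
}.

(* B = H (+) V for subbundles H, V with typical fibres F1, F2: B is locally
   U x (F1 x F2) with H = U x (F1 x 0) and V = U x (0 x F2). *)
Definition whitney_sum (H V : forall x, set (B x)) : Prop :=
  exists F1 F2 : convenientType R, forall x0, exists (U : set M)
    (phi : forall x, B x -> (F1 * F2)%type),
    [/\ U x0, local_trivialization U phi &
      forall x, U x -> forall b : B x,
        (H x b <-> (phi x b).2 = 0) /\ (V x b <-> (phi x b).1 = 0)].

End Bundles.

Record vector_bundle (R : realType) (E : convenientType R) (M : manifold E)
    (F : convenientType R) := VectorBundle {
  bundle_of :> bundle M F ;
  vector_bundleP : is_vector_bundle bundle_of
}.

(* Smoothness of a fibrewise map over the identity: around every point, some
   local representative is smooth. *)
Definition smooth_hom (R : realType) (E : convenientType R) (M : manifold E)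
    (F F' : convenientType R) (B : bundle M F) (B' : bundle M F')
    (f : forall x, B x -> B' x) : Prop :=
  forall x0, exists i k k',
    [/\ chart_dom i x0, triv_dom k x0, triv_dom k' x0 &
      smooth_along (over (chart_dom i `&` triv_dom k `&` triv_dom k'))
        (total_coord i k) (fun b : total B => triv k' (f _ (projT2 b)))].

Section Tangent.
Context {R : realType} {E : convenientType R} (M : manifold E).

Definition chart_inv (x : M) : E -> M :=
  'pinv_(fun=> x) (chart_dom (chart_at x)) (chart (chart_at x)).

(* A tangent vector at x is an equivalence class of pairs (chart around x,
   vector of E), modulo the derivatives of the chart changes; each class has
   exactly one representative in the selected chart [chart_at x], so the tangent
   space is the model space E.  The trivialization given by a chart j
   is v |-> D(chart_j o chart_(chart_at x)^-1)(v). *)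
Definition tangent : bundle M E := {|
  fibre := fun=> E ;
  triv_dom := @chart_dom _ _ M ;
  triv := fun j x (v : E) =>
    dirD (chart j \o chart_inv x) (chart (chart_at x) x) v ;
  triv_at := @chart_at _ _ M |}.

End Tangent.

(* The tangent map of f at x, read in the selected charts at x and f x. *)
Definition tangent_map (R : realType) (E E' : convenientType R)
    (M : manifold E) (M' : manifold E') (f : M -> M') (x : M)
    (v : tangent M x) : tangent M' (f x) :=
  dirD (chart (chart_at (f x)) \o f \o chart_inv x) (chart (chart_at x) x) v.

Section OpenPart.
Context {R : realType} {E : convenientType R} (M : manifold E).
Variables (O : set M) (oO : mopen O).

Let pt := set_type O.
Let dom (i : chart_ix M) : set pt := val @^-1` chart_dom i.
Let ch (i : chart_ix M) : pt -> E := chart i \o val.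

Let ch_inj i : {in dom i &, injective (ch i)}.
Proof.
move=> x y; rewrite !inE => ix iy e; apply: val_inj.
by apply: chart_inj e; rewrite inE.
Qed.

Let image_chart i (S T : set M) :
  chart i @` (chart_dom i `&` (S `&` T)) =
  (chart i @` (chart_dom i `&` S)) `&` (chart i @` (chart_dom i `&` T)).
Proof.
apply/seteqP; split=> [_ [x [ix [Sx Tx]] <-]|_ [[x [ix Sx] <-] [y [iy Ty] e]]].
  by split; exists x.
have yx : y = x by apply: (@chart_inj _ _ M i) e; rewrite inE.
by exists x => //; do 2!split => //; rewrite -yx.
Qed.

Let ch_open i j : cinf_open (ch i @` (dom i `&` dom j)).
Proof.
have -> : ch i @` (dom i `&` dom j) =
    (chart i @` (chart_dom i `&` chart_dom j)) `&`
    (chart i @` (chart_dom i `&` O)).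
  rewrite -image_chart; apply/seteqP; split=> [_ [x [ix jx] <-]|].
    by exists (val x) => //; do 2!split => //; exact: set_valP.
  by move=> _ [x [ix [jx Ox]] <-]; exists (SigSub (mem_set Ox)).
by move=> c sc; rewrite preimage_setI; apply: openI;
  [exact: chart_open|exact: oO].
Qed.

Let ch_change i j : smooth_along (dom i `&` dom j) (ch i) (ch j).
Proof. by move=> g gP; apply: (@chart_change _ _ M i j (val \o g)). Qed.

(* The open submanifold O of M. *)
Definition open_part : manifold E :=
  @Manifold R E pt (chart_ix M) dom ch (chart_at \o val)
    (fun x => mem_chart_at (val x)) ch_inj ch_open ch_change.

End OpenPart.

Section Total.
Context {R : realType} {E : convenientType R} {M : manifold E}
  {F : convenientType R} (B : vector_bundle M F).

Let ix := (chart_ix M * triv_ix B)%type.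
Let dom (a : ix) : set (total B) :=
  over (chart_dom a.1 `&` triv_dom a.2).
Let ch (a : ix) : total B -> E * F := total_coord a.1 a.2.

Let ch_mem (b : total B) : dom (chart_at (projT1 b), triv_at (projT1 b)) b.
Proof.
by split; [exact: mem_chart_at|exact: mem_triv_at (vector_bundleP B) _].
Qed.

Let ch_inj a : {in dom a &, injective (ch a)}.
Proof.
move=> [x b] [y c]; rewrite !inE => -[/= ax kx] [/= ay ky] [exy].
have {exy} xy : x = y by apply: chart_inj exy; rewrite inE.
case: y / xy c ay ky => c ay ky e; congr existT.
exact: (bij_inj (triv_bij (vector_bundleP B) kx)) e.
Qed.

Let ch_open a a' : cinf_open (ch a @` (dom a `&` dom a')).
Proof.
move: a a' => [i k] [j l] /=.
pose I S := chart i @` (chart_dom i `&` S).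
have -> : ch (i, k) @` (dom (i, k) `&` dom (j, l)) = [set p |
    I (chart_dom j) p.1 /\ I (triv_dom k : set M) p.1 /\
    I (triv_dom l : set M) p.1].
  apply/seteqP; split=> [_ [[x b] [[/= ax kx] [/= jx lx]] <-] /=|].
    by split; [|split]; exists x.
  move=> [z v] /= [[x [ax jx] xz] [[y [iy ky] yz] [y' [iy' ly'] yz']]].
  have yx : y = x by apply: (@chart_inj _ _ M i); rewrite ?inE// yz.
  have yx' : y' = x by apply: (@chart_inj _ _ M i); rewrite ?inE// yz'.
  move: ky ly'; rewrite yx yx' => kx lx.
  have [g _ gK] := triv_bij (vector_bundleP B) kx.
  exists (existT _ x (g v)) => //.
  by rewrite /ch /total_coord /= gK xz.
move=> c sc; have sc1 := smooth_fst sc.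
have -> : c @^-1` [set p | I (chart_dom j) p.1 /\ I (triv_dom k : set M) p.1 /\
    I (triv_dom l : set M) p.1] =
    ((fst \o c) @^-1` I (chart_dom j)) `&`
    (((fst \o c) @^-1` I (triv_dom k)) `&` ((fst \o c) @^-1` I (triv_dom l))).
  by [].
apply: openI; first exact: chart_open.
by apply: openI; exact: triv_dom_open (vector_bundleP B) _ _ _ _.
Qed.

Let ch_change a a' : smooth_along (dom a `&` dom a') (ch a) (ch a').
Proof.
move: a a' => [i k] [j l] g gP sg; apply: smooth_pair.
  apply: (@chart_change _ _ M i j (@projT1 _ _ \o g)).
    by move=> t; have [[/= ? _] [? _]] := gP t.
  exact: smooth_fst sg.
apply: (triv_change (vector_bundleP B) _ sg).
by move=> t; have [[/= ? ?] [? ?]] := gP t.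
Qed.

(* The total space, with charts (x, b) |-> (chart_i x, triv_k b). *)
Definition total_manifold : manifold (E * F)%type :=
  @Manifold R (E * F)%type (total B) ix dom ch
    (fun b => (chart_at (projT1 b), triv_at (projT1 b)))
    ch_mem ch_inj ch_open ch_change.

Definition bundle_proj (m : total_manifold) : M := projT1 m.

Definition bounded_bilinear (f : E -> F -> F) : Prop :=
  [/\ forall v, linear (f v), forall e, linear (f ^~ e) &
      forall (C : set E) (D : set F), vN_bounded C -> vN_bounded D ->
        vN_bounded [set f p.1 p.2 | p in C `*` D]].

Definition vertical_tangent (m : total_manifold) :
    set (tangent total_manifold m) :=
  [set xi | tangent_map bundle_proj xi = 0].

(* Over a chart i of M and a trivialization k of B, the tangent vectors to B are
   trivialized by the chart (i, k) of the total space; Gamma is a function of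
   the coordinate z = chart_i x, and its smooth dependence on z is the joint
   smoothness of (z, v, e) |-> Gamma_z(v, e). *)
Definition linear_connection
    (H : forall m : total_manifold, set (tangent total_manifold m)) : Prop :=
  whitney_sum H vertical_tangent /\
  forall (i : chart_ix M) (k : triv_ix B), exists Gamma : E -> E -> F -> F,
    let D := chart_dom i `&` triv_dom k in
    [/\ forall z, (chart i @` D) z -> bounded_bilinear (Gamma z),
        smooth_along [set q : E * E * F | (chart i @` D) q.1.1] id
          (fun q => Gamma q.1.1 q.1.2 q.2) &
        forall m : total_manifold, over D m ->
          triv ((i, k) : triv_ix (tangent total_manifold)) @` H m =
          [set (v, - Gamma (chart i (projT1 m)) v (triv k (projT2 m)))
            | v in [set: E]]].

End Total.

Section Prolongation.
Context {R : realType} {E : convenientType R} {M : manifold E}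
  {FA F : convenientType R}.
Variables (A : vector_bundle M FA).

Record anchor := Anchor {
  anchor_fun :> forall x, {linear A x -> tangent M x} ;
  anchor_smooth : smooth_hom anchor_fun
}.

Variables (rho : anchor) (B : vector_bundle M F).

(* O is onto M and, over a cover of M by chart domains U trivializing A and B,
   some trivialization of B over U sends the part of O over U onto U x OO, with
   OO a fixed open subset of the typical fibre F. *)
Definition surjective_fibration (O : set (total_manifold B)) : Prop :=
  (forall x : M, exists2 m, O m & bundle_proj m = x) /\
  exists2 OO : set F, cinf_open OO &
  forall x0 : M, exists (U : set M) (i : chart_ix M)
      (psiA : forall x, A x -> FA) (psi : forall x, B x -> F),
    [/\ U x0, U `<=` chart_dom i, local_trivialization U psiA,
        local_trivialization U psi &
        forall m : total_manifold B, U (bundle_proj m) ->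
          (O m <-> OO (psi _ (projT2 m)))].

Variables (O : set (total_manifold B)) (oO : mopen O).
Let MM := open_part oO.

Definition open_proj (m : MM) : M := bundle_proj (val m).

Lemma tangent_open_proj (m : MM) (xi : tangent MM m) :
  tangent_map open_proj xi = xi.1.
Proof.
set z := chart (chart_at m) m; set i := chart_at m.
pose U := chart i @` (chart_dom i : set (MM)).
have U0 : \forall t \near (0 : R), U (z + t *: xi).
  have oU : cinf_open U.
    by rewrite /U -[chart_dom i]setIid; exact: (@chart_open _ _ (MM)).
  have := oU _ (smooth_line z xi); rewrite openE => /(_ 0); apply.
  rewrite /= scale0r addr0; exists m => //; exact: mem_chart_at.
apply: dirD_eq.
have projE t : U (z + t *: xi) ->
   (chart (chart_at (open_proj m)) \o open_proj \o chart_inv m) (z + t *: xi)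
    = z.1 + t *: xi.1.
  move=> Ut; rewrite -[RHS]/((z + t *: xi).1).
  have /(_ (mem_set Ut)) := @pinvK _ _ (fun=> m) (chart_dom i) (chart i) (z + t *: xi).
  by move=> /(congr1 fst).
apply: (cvg_near_cst); near=> h.
have h0 : h != 0 by near: h; exact: nbhs_dnbhs_neq.
rewrite !projE; last 2 first.
- exact: nbhs_singleton U0.
- by rewrite add0r; near: h; exact: nbhs_dnbhs.
by rewrite scale0r addr0 add0r (addrC z.1) addrK scalerA mulVf// scale1r.
Unshelve. all: by end_near. Qed.

(* T_m O = { (a, mu) in A_p(m) x T_m O | rho a = Tp mu } *)
Definition prolong_pred (m : MM) : {pred A (open_proj m) * tangent MM m} :=
  [pred u | rho (open_proj m) u.1 == tangent_map open_proj u.2].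

Let prolong_submod m : submod_closed (@prolong_pred m).
Proof.
split; first by rewrite inE /= linear0 tangent_open_proj.
move=> a u v; rewrite !inE /= !tangent_open_proj => /eqP uP /eqP vP.
by rewrite linearP uP vP.
Qed.

HB.instance Definition _ (m : MM) := GRing.isSubmodClosed.Build R
  (A (open_proj m) * tangent MM m)%type (@prolong_pred m) (@prolong_submod m).

Definition prolong_fibre (m : MM) := {u | u \in @prolong_pred m}.
HB.instance Definition _ (m : MM) := SubType.on (prolong_fibre m).
HB.instance Definition _ (m : MM) := [Choice of prolong_fibre m by <:].
HB.instance Definition _ (m : MM) :=
  [SubChoice_isSubLmodule of prolong_fibre m by <:].

(* Over the chart (i, k) of O and the trivialization l of A, mu has coordinates
   (rho a, w) by the condition rho a = Tp mu, so (a, w) with a in the typical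
   fibre of A and w in that of B are the coordinates of (a, mu). *)
Definition prolongation : bundle MM (FA * F)%type := {|
  fibre := fun m => prolong_fibre m : lmodType R ;
  triv_dom := fun a : triv_ix (tangent MM) * triv_ix A =>
    triv_dom a.1 `&` (open_proj @^-1` triv_dom a.2) ;
  triv := fun a m (u : prolong_fibre m) =>
    (triv a.2 (val u).1, (triv a.1 (val u).2).2) ;
  triv_at := fun m => (triv_at m, triv_at (open_proj m)) |}.

Definition vertical_prolongation (m : MM) : set (prolongation m) :=
  [set u | (val (u : prolong_fibre m)).1 = 0].

End Prolongation.

(* The two descriptions of a connection complementing the subbundle V are both
   required: a vector bundle endomorphism N with N^2 = Id and Ker (Id + N) = V,
   and the Whitney decomposition B = Ker (Id - N) (+) V. *)
Definition connection (R : realType) (E : convenientType R) (M : manifold E)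
    (F : convenientType R) (B : bundle M F) (V : forall x, set (B x))
    (N : forall x, {linear B x -> B x}) : Prop :=
  [/\ smooth_hom N,
      forall x b, N x (N x b) = b,
      forall x b, V x b <-> b + N x b = 0 &
      whitney_sum (fun x => [set b | b - N x b = 0]) V].

(* Main.v *)
(* In the selected chart of the total space at m, the connection is the graph of
   v |-> - K_m(v), and N (a, (v, w)) = (a, (v, - w - 2 K_m(v))) with v = rho a.
   To see that N is smooth, read it in a fixed chart.  The transition maps of
   the total space are of the form (z, e) |-> (phi z, g(z) e) with g(z) linear,
   so their derivatives split off the vertical directions without any general
   additivity of directional derivatives, and the vertical part w + K_m(v) is
   simply transformed by g.  In a fixed chart, N is therefore
   (a, w) |-> (a, - w - 2 Gamma_z(rho a, e)), smooth because Gamma and rho are,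
   and (a, w + Gamma_z(rho a, e)) trivializes the Whitney decomposition. *)
From HB Require Import structures.
From mathcomp Require Import all_boot all_order all_algebra.
From mathcomp Require Import all_classical reals topology normedtype.
From mathcomp Require Import derive realfun trigo.
Require Import Defs.

Set Implicit Arguments.
Unset Strict Implicit.
Unset Printing Implicit Defensive.

Import Order.TTheory GRing.Theory Num.Theory.
Import numFieldNormedType.Exports.

Local Open Scope classical_set_scope.
Local Open Scope ring_scope.

(** * Derivatives and smooth curves in topological vector spaces *)

Section Curves.
Context {R : realType}.
Implicit Types E F : tvsType R.

Lemma tvs_cvgD T (G : set_system T) {FG : Filter G} E (f g : T -> E) a b :
  f @ G --> a -> g @ G --> b -> (fun t => f t + g t) @ G --> a + b.
Proof. by apply: continuous2_cvg; exact: (@add_continuous E (a, b)). Qed.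

Lemma tvs_cvgZ T (G : set_system T) {FG : Filter G} E (r : T -> R) (f : T -> E)
    (k : R) a :
  r @ G --> k -> f @ G --> a -> (fun t => r t *: f t) @ G --> k *: a.
Proof.
move=> rk fa.
exact: (@continuous2_cvg T R^o E E G FG r f (fun x y => x *: y) k a
  (@scale_continuous R E (k, a)) rk fa).
Qed.

Lemma is_derivD E (c d : R -> E) t a b :
  is_deriv c t a -> is_deriv d t b -> is_deriv (fun s => c s + d s) t (a + b).
Proof.
move=> ca db; rewrite /is_deriv; under eq_fun do
  rewrite opprD addrACA scalerDr.
exact: tvs_cvgD.
Qed.

Lemma is_derivZ E (c : R -> E) k t a :
  is_deriv c t a -> is_deriv (fun s => k *: c s) t (k *: a).
Proof.
move=> ca; rewrite /is_deriv; under eq_fun do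
  rewrite -scalerBr scalerA mulrC -scalerA.
by apply: tvs_cvgZ => //; exact: cvg_cst.
Qed.

Lemma is_deriv_near E (c d : R -> E) t a :
  (\forall s \near t, c s = d s) -> is_deriv c t a -> is_deriv d t a.
Proof.
move=> cd ca; apply: cvg_trans ca; apply: near_eq_cvg.
have cdt := nbhs_singleton cd.
have := cd; rewrite (near_shift 0) /= => /nbhs_dnbhs; apply: filterS => h.
by rewrite /= subr0 addrC cdt => ->.
Qed.

Lemma is_deriv_cvg E (c : R -> E) t a :
  is_deriv c t a -> c (t + h) @[h --> 0^'] --> c t.
Proof.
move=> ca.
have h0 : (fun h : R => h) @ 0^' --> (0 : R) by move=> A; exact: nbhs_dnbhs.
have := tvs_cvgD (cvg_cst (c t)) (tvs_cvgZ h0 ca).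
rewrite scale0r addr0 => /(_ _ _ _) lim; refine (cvg_trans (near_eq_cvg _) lim).
near=> h; have hn0 : h != 0 by near: h; exact: nbhs_dnbhs_neq.
by rewrite /= scalerA mulfV// scale1r addrC subrK.
Unshelve. all: by end_near. Qed.

(** The difference quotient of [c \o u] is [h^-1 * u h] times that of [c] at step [u h]. Convergence
    of [u] to the punctured filter [0^'] keeps [u h] nonzero, so that this factor may be
    cancelled. *)
Lemma is_deriv_comp E (c : R -> E) (u : R -> R) (k : R) a :
  u 0 = 0 -> u @ 0^' --> 0^' -> (fun h => h^-1 * u h) @ 0^' --> k ->
  is_deriv c 0 a -> is_deriv (c \o u) 0 (k *: a).
Proof.
move=> u0 uc uk ca.
have := tvs_cvgZ uk (cvg_comp _ _ uc ca).
move=> /(_ _) lim; refine (cvg_trans (near_eq_cvg _) lim); near=> h.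
have un0 : u h != 0.
  near: h; apply: (uc (fun y : R => y != 0)); exact: (nbhs_dnbhs_neq (0 : R)).
by rewrite /= !add0r u0 scalerA mulfK.
Unshelve. all: by end_near. Qed.

Lemma smooth_curveD E (c d : R -> E) :
  smooth_curve c -> smooth_curve d -> smooth_curve (fun s => c s + d s).
Proof.
move=> [c' [<- cP]] [d' [<- dP]]; exists (fun n s => c' n s + d' n s).
by split=> // n t; exact: is_derivD.
Qed.

Lemma smooth_curveZ E (c : R -> E) k :
  smooth_curve c -> smooth_curve (fun s => k *: c s).
Proof.
move=> [c' [<- cP]]; exists (fun n s => k *: c' n s).
by split=> // n t; exact: is_derivZ.
Qed.

Lemma smooth_curve_sin E (z v : E) :
  smooth_curve (fun s : R => z + sin s *: v).
Proof.
(* Each differentiation of [sin] advances its argument by a quarter turn; the constant [z] survives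
   only at order 0. *)
pose d n (s : R) := sin (s + (pi / 2) *+ n) *: v.
exists (fun n => match n with 0%N => fun s => z + sin s *: v | n => d n end).
split=> // n t; suff dP : is_deriv (d n) t (d n.+1 t).
  case: n dP => // d0.
  have := is_derivD (is_deriv_cst z t) d0; rewrite add0r.
  by congr is_deriv; apply/funext => s; rewrite /d mulr0n addr0.
rewrite /d (mulrSr (pi / 2)) addrA sinDpihalf; set p := _ *+ n.
have [+ dv] := @is_derive_sin R (t + p).
rewrite /derivable -/(derive _ _ _) dv => sinP.
rewrite /is_deriv /=; under eq_fun do rewrite -scalerBl scalerA.
apply: tvs_cvgZ; last exact: cvg_cst.
refine (cvg_trans (near_eq_cvg _) sinP); near=> h.
by rewrite /= [h%:A]mulr1 [h + _]addrC addrAC.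
Unshelve. all: by end_near. Qed.

Lemma line_near E (U : set E) x v :
  cinf_open U -> U x -> \forall t \near (0 : R), U (x + t *: v).
Proof.
move=> oU Ux; have := oU _ (smooth_line x v); rewrite openE => /(_ 0); apply.
by rewrite /= scale0r addr0.
Qed.

(* A smooth curve inside U must be defined on all of R: run through the line
   with speed profile [eps * sin], which stays near z, and undo this
   reparametrization by arcsin. *)
Lemma deriv_along E F (U : set E) (f : E -> F) z v :
  cinf_open U -> smooth_along U id f -> U z ->
  exists d, is_deriv (fun t : R => f (z + t *: v)) 0 d.
Proof.
move=> oU sf Uz.
have /nbhs_ballP[e /= e0 eU] := line_near v oU Uz.
(* The factor 2 keeps [sin s / k] within [e / 2], strictly inside the ball of radius [e]. *)
pose k := 2 / e; have k0 : k != 0 by rewrite gt_eqF// divr_gt0.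
have [d dP] : exists d, is_deriv (fun s => f (z + sin s *: (k^-1 *: v))) 0 d.
  have [||d' [d0 d'P]] := sf (fun s => z + sin s *: (k^-1 *: v)).
  - move=> s; rewrite scalerA; apply: eU.
    rewrite /ball/= sub0r normrN normrM.
    apply: (@le_lt_trans _ _ (1 * `|k^-1|)).
      by rewrite ler_wpM2r// ler_norml sin_geN1 sin_le1.
    by rewrite mul1r /k invf_div gtr0_norm ?divr_gt0// ltr_pdivrMr// mulr_natr
      mulr2n ltrDr.
  - exact: smooth_curve_sin.
  - by exists (d' 1%N 0); have := d'P 0%N 0; rewrite d0.
pose u h : R := asin (k * h).
have nk : \forall h \near (0 : R), sin (u h) = k * h.
  near=> h; rewrite asinK// in_itv /= -ler_norml normrM.
  rewrite -ler_pdivlMl ?normr_gt0// mulr1 ltW//; near: h.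
  by apply: (@nbhs0_lt R R); rewrite invr_gt0 normr_gt0.
have au0 : asin (0 : R) = 0.
  rewrite -[X in asin X]sin0 sinK// in_itv /= oppr_le0.
  by rewrite divr_ge0 ?pi_ge0.
have ud : is_derive (0 : R) 1 u k.
  have d1 : is_derive (k * 0 : R) 1 asin 1.
    have := @is_derive1_asin R (k * 0).
    by rewrite mulr0 expr0n subr0 sqrtr1 invr1 oppr_lt0 ltr01; exact.
  rewrite -[k]mul1r; apply: (is_derive1_comp d1).
  have dk := @is_deriveZ R R R id k 0 1 1 (is_derive_id _ _).
  by move: dk; rewrite [k *: 1]mulr1.
have uq : (fun h => h^-1 * u h) @ 0^' --> k.
  have [+ <-] := ud; rewrite /derivable -/(derive _ _ _) => dq.
  refine (cvg_trans (near_eq_cvg _) dq); near=> h.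
  by rewrite /= addr0 [h%:A]mulr1 {2}/u mulr0 au0 subr0.
exists (k *: d); apply: is_deriv_near (is_deriv_comp _ _ uq dP).
- near=> h; have su : sin (u h) = k * h by near: h.
  by rewrite /= su scalerA mulrAC mulfV// mul1r.
- by rewrite /u mulr0.
- have uc : u h @[h --> (0 : R)] --> u 0.
    by have [/derivable1_diffP/differentiable_continuous + _] := ud.
  move=> A /= A0; have {A0} /uc uA : nbhs (u 0) [set y | y != 0 -> A y].
    by rewrite /u mulr0 au0.
  have {}uA : \forall h \near 0^', u h != 0 -> A (u h) by exact: nbhs_dnbhs.
  (* Near 0, [sin (u h) = k * h], so [u h = 0] would force [h = 0]. *)
  rewrite /nbhs /=; near=> h; apply: (near uA h) => //; apply/eqP => uh0.
  have kh : k * h = 0.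
    have <- : sin (u h) = k * h by near: h; exact: nbhs_dnbhs.
    by rewrite uh0 sin0.
  have h0 : h != 0 by near: h; exact: nbhs_dnbhs_neq.
  by move/eqP: kh; rewrite mulf_eq0 (negPf k0) (negPf h0).
Unshelve. all: by end_near. Qed.

(** The difference quotient of [t *: h t] at 0 is [h t] itself, so a limit of [h] does the work of a
    product rule. *)
Lemma is_deriv_scale_id E (h : R -> E) l :
  h t @[t --> 0^'] --> l -> is_deriv (fun t => t *: h t) 0 l.
Proof.
move=> hl; refine (cvg_trans (near_eq_cvg _) hl); near=> t.
have t0 : t != 0 by near: t; exact: nbhs_dnbhs_neq.
by rewrite !add0r scale0r subr0 scalerA mulVf// scale1r.
Unshelve. all: by end_near. Qed.

Lemma dirD_near E F (f g : E -> F) x v :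
  (\forall t \near (0 : R), f (x + t *: v) = g (x + t *: v)) ->
  dirD f x v = dirD g x v.
Proof.
move=> fg; congr xget; apply/seteqP; split=> d; first exact: is_deriv_near.
by apply: is_deriv_near; apply: filterS fg => t.
Qed.

End Curves.

(** * Inverse charts *)

Section Charts.
Context {R : realType} {E : convenientType R} (M : manifold E).

Lemma chartK (x y : M) : chart_dom (chart_at x) y ->
  chart_inv x (chart (chart_at x) y) = y.
Proof. by move=> xy; rewrite /chart_inv pinvKV ?inE//; exact: chart_inj. Qed.

Lemma chart_inv_mem (x : M) (S : set M) z :
  (chart (chart_at x) @` (chart_dom (chart_at x) `&` S)) z ->
  [/\ chart_dom (chart_at x) (chart_inv x z), S (chart_inv x z) &
      chart (chart_at x) (chart_inv x z) = z].
Proof. by move=> [y [xy Sy] <-]; rewrite chartK. Qed.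

Lemma smooth_chart_inv (x : M) j :
  smooth_along (chart (chart_at x) @` (chart_dom (chart_at x) `&` chart_dom j))
    id (chart j \o chart_inv x).
Proof.
move=> g gP sg; have gM t := chart_inv_mem (gP t).
apply: (@chart_change _ _ M (chart_at x) j (chart_inv x \o g)).
  by move=> t; have [] := gM t.
rewrite (_ : _ \o _ = g)//; apply/funext => t /=.
by have [] := gM t.
Qed.

(** Near the coordinates of [x], the selected chart composed with its own inverse is the
    identity. *)
Lemma triv_tangent_at (x : M) (v : tangent M x) :
  triv (chart_at x : triv_ix (tangent M)) v = v.
Proof.
set z := chart (chart_at x) x.
apply: dirD_eq; apply: (@is_deriv_near _ E) (@is_deriv_line _ E z v 0).
set s := chart_at x.
have : (chart s @` (chart_dom s `&` chart_dom s)) z.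
  by exists x => //; split; exact: mem_chart_at.
move=> /(line_near v (@chart_open _ _ M _ _)); apply: filterS => t.
by move=> /chart_inv_mem[].
Qed.

End Charts.

(** * Inverse trivializations of a vector bundle *)

Section Transition.
Context {R : realType} {E : convenientType R} {M : manifold E}
  {F : convenientType R} (B : vector_bundle M F).

(** Made total by [xget] with default 0; it is an inverse of [triv k] only over [triv_dom k]. *)
Definition triv_inv (k : triv_ix B) (x : M) (y : F) : B x :=
  xget 0 [set b | triv k b = y].

Variables (k : triv_ix B) (x : M) (kx : triv_dom k x).

Lemma triv_invK y : triv k (triv_inv k x y) = y.
Proof.
have [g _ gK] := triv_bij (vector_bundleP B) kx.
rewrite /triv_inv; case: xgetP => [b -> //|/(_ (g y))]; by rewrite /= gK.
Qed.

Lemma trivK b : triv_inv k x (triv k b) = b.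
Proof.
apply: (bij_inj (triv_bij (vector_bundleP B) kx)); exact: triv_invK.
Qed.

Lemma triv_inv_linear : linear (triv_inv k x).
Proof.
move=> a u v; apply: (bij_inj (triv_bij (vector_bundleP B) kx)).
by rewrite (triv_linear (vector_bundleP B) kx) !triv_invK.
Qed.

Lemma triv0 : triv k (0 : B x) = 0.
Proof.
have := triv_linear (vector_bundleP B) kx (-1) 0 0.
by rewrite !scaler0 addr0 scaleN1r addNr.
Qed.

Lemma triv_eq0 (b : B x) : triv k b = 0 <-> b = 0.
Proof.
split=> [|->]; last exact: triv0.
by rewrite -triv0 => /(bij_inj (triv_bij (vector_bundleP B) kx)).
Qed.

End Transition.

(** * Tangent vectors of the total space under a change of chart *)

Section TotalTangent.
Context {R : realType} {E : convenientType R} {M : manifold E}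
  {F : convenientType R} (B : vector_bundle M F).

Lemma chart_inv_total (m : total_manifold B) z y :
  let x := projT1 m in
  (chart (chart_at x) @`
    (chart_dom (chart_at x) `&` triv_dom (triv_at x : triv_ix B))) z ->
  chart_inv m (z, y) = existT _ (chart_inv x z) (triv_inv (triv_at x) _ y).
Proof.
move=> x /chart_inv_mem[xz rz zK].
set m' := existT _ _ _.
have -> : (z, y) = chart (chart_at m) m'.
  by congr pair; rewrite ?zK//= triv_invK.
by rewrite chartK.
Qed.

(* The transition maps of the total space are linear in the fibre coordinate,
   so their derivative is additive in the vertical direction. *)
Lemma triv_total_tangent (m : total_manifold B) i k (v : E) :
  over (chart_dom i `&` triv_dom k) m ->
  exists a, forall w,
    triv ((i, k) : triv_ix (tangent (total_manifold B)))
      ((v, w) : tangent (total_manifold B) m) =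
    (triv (i : triv_ix (tangent M)) (v : tangent M (projT1 m)),
     a + triv k (triv_inv (triv_at (projT1 m)) (projT1 m) w)).
Proof.
case: m => x b [/= ix kx]; set m : total_manifold B := existT _ x b.
set s := chart_at x; set r : triv_ix B := triv_at x.
set z := chart s x; set e := triv r b.
have rx : triv_dom r x := mem_triv_at (vector_bundleP B) x.
pose f : E * F -> E * F :=
  @chart _ _ (total_manifold B) (i, k) \o chart_inv m.
pose U := @chart _ _ (total_manifold B) (s, r) @`
  (@chart_dom _ _ (total_manifold B) (s, r) `&`
   @chart_dom _ _ (total_manifold B) (i, k)).
have oU : cinf_open U by exact: (@chart_open _ _ (total_manifold B)).
have Uz w : U (z, w).
  exists (existT _ x (triv_inv r x w)).
    by do !split => //; exact: mem_chart_at.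
  by congr pair; rewrite triv_invK.
pose S := chart_dom i `&` (triv_dom r `&` triv_dom k).
have nz : \forall t \near (0 : R),
    (chart s @` (chart_dom s `&` S)) (z + t *: v).
  have := line_near (v, 0) oU (Uz 0); apply: filterS => t [[y c]].
  move=> [[/= sy ry] [/= iy ky]] [/= <- _].
  by exists y.
(* The transition map in coordinates: its base part ignores the fibre coordinate, and its fibre part
   is linear in it. *)
have fE t w : (chart s @` (chart_dom s `&` S)) (z + t *: v) ->
    forall y, f ((z, w) + t *: (v, y)) = (chart i (chart_inv x (z + t *: v)),
      triv k (triv_inv r (chart_inv x (z + t *: v)) (w + t *: y))).
  move=> zS y; rewrite /f /= -[(z, w) + _]/(z + t *: v, w + t *: y).
  rewrite chart_inv_total//=; case: zS => p [sp [? [? ?]]] <-.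
  by exists p.
have df w : exists d, is_deriv (fun t => f ((z, w) + t *: (v, 0))) 0 d.
  apply: (deriv_along _ oU) => //.
  exact: (@smooth_chart_inv _ _ (total_manifold B) m (i, k)).
(* Of this derivative along [(v, 0)], taken at the coordinates of [m], the fibre component [d2] is
   the offset [a]. *)
have [[d1 d2] d0] := df e.
have d1E : triv (i : triv_ix (tangent M)) (v : tangent M x) = d1.
  apply: dirD_eq; apply: is_deriv_near (is_deriv_fst d0).
  by apply: filterS nz => t zS; exact: (congr1 fst (fE t e zS 0)).
exists d2 => w; rewrite /= in d1E; rewrite d1E /=.
apply: dirD_eq.
have [d' d'P] := df w.
have nz0 := nbhs_singleton nz.
(* Differentiability along the line gives continuity, and at [t = 0] the base point is [x]. *)
have gw : (f ((z, w) + t *: (v, 0))).2 @[t --> 0^'] --> triv k (triv_inv r x w).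
  have -> : triv k (triv_inv r x w) = (f ((z, w) + 0 *: (v, 0))).2.
    by rewrite (fE 0 w nz0) !scale0r !addr0 chartK//; exact: mem_chart_at.
  have /is_deriv_cvg := is_deriv_snd d'P.
  by under eq_fun do rewrite add0r.
(* By linearity in the fibre, the fibre part of [f] at [(z, e) + t *: (v, w)] is its value at
   [(z, e) + t *: (v, 0)] plus [t] times its value at [(z, w) + t *: (v, 0)]. *)
have gd := is_derivD (is_deriv_snd d0) (is_deriv_scale_id gw).
apply: is_deriv_near (is_deriv_pair (is_deriv_fst d0) gd).
apply: filterS nz => t zS; rewrite -[RHS]/(f ((z, e) + t *: (v, w))).
have ry : triv_dom r (chart_inv x (z + t *: v)).
  by have [_ [_ []]] := chart_inv_mem zS.
have ky : triv_dom k (chart_inv x (z + t *: v)).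
  by have [_ [_ []]] := chart_inv_mem zS.
rewrite -[LHS]/((f ((z, e) + t *: (v, 0))).1,
  (f ((z, e) + t *: (v, 0))).2 + t *: (f ((z, w) + t *: (v, 0))).2).
rewrite !fE//= scaler0 !addr0; congr pair.
rewrite [e + _]addrC (triv_inv_linear ry).
by rewrite (triv_linear (vector_bundleP B) ky) addrC.
Qed.

End TotalTangent.

(** * Natural topology of total spaces and open submanifolds *)

Section NaturalTopology.
Context {R : realType} {E : convenientType R}.

Lemma mopen_chart_dom (M : manifold E) (i : chart_ix M) : mopen (chart_dom i).
Proof. by move=> j; exact: chart_open. Qed.

(** Charts are injective on their domains, so taking images commutes with intersection. *)
Lemma mopenI (M : manifold E) (S T : set M) :
  mopen S -> mopen T -> mopen (S `&` T).
Proof.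
move=> oS oT i c sc.
have -> : chart i @` (chart_dom i `&` (S `&` T)) =
    (chart i @` (chart_dom i `&` S)) `&` (chart i @` (chart_dom i `&` T)).
  apply/seteqP; split=> [_ [x [ix [Sx Tx]] <-]|]; first by split; exists x.
  move=> _ [[x [ix Sx] <-] [y [iy Ty] e]].
  have yx : y = x by apply: (@chart_inj _ _ M i) e; rewrite inE.
  by exists x => //; do 2!split => //; rewrite -yx.
by rewrite preimage_setI; apply: openI; [exact: oS|exact: oT].
Qed.

Lemma mopen_val (M : manifold E) (O : set M) (oO : mopen O) (S : set M) :
  mopen S -> mopen (val @^-1` S : set (open_part oO)).
Proof.
move=> oS i; rewrite [X in cinf_open X](_ : _ =
  chart (i : chart_ix M) @` (chart_dom (i : chart_ix M) `&` (O `&` S))).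
  exact: mopenI.
apply/seteqP; split=> [_ [x [ix Sx] <-]|_ [x [ix [Ox Sx]] <-]].
  by exists (val x) => //; do 2!split => //; exact: set_valP.
by exists (SigSub (mem_set Ox)).
Qed.

(** Continuity of the projection: in a bundle chart the preimage of [S] is a cylinder, restricting
    the base coordinate only. *)
Lemma mopen_bundle_proj (M : manifold E) (F : convenientType R)
    (B : vector_bundle M F) (S : set M) :
  mopen S -> mopen (@bundle_proj _ _ _ _ B @^-1` S).
Proof.
move=> oS [i k].
pose I := chart i @` (chart_dom i `&` (triv_dom k `&` S)).
rewrite [X in cinf_open X](_ : _ = [set p | I p.1]).
  move=> c /smooth_fst sc.
  have ok : mopen (triv_dom k) by exact: triv_dom_open (vector_bundleP B) _.
  by apply: (mopenI ok oS).
apply/seteqP; split=> [_ [x [[/= ix kx] Sx] <-]|[_ v] [/= x [ix [kx Sx]] <-]].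
  by exists (projT1 x).
exists (existT _ x (triv_inv k x v)) => //.
by congr pair; exact: triv_invK.
Qed.

(** The inverse charts of [M] and of its open part agree on the chart image of the open part, which
    contains the line near [t = 0]. *)
Lemma triv_tangent_open_part (M : manifold E) (O : set M) (oO : mopen O)
    (m : open_part oO) (j : chart_ix M) (v : E) :
  triv (j : triv_ix (tangent (open_part oO))) (v : tangent (open_part oO) m) =
  triv (j : triv_ix (tangent M)) (v : tangent M (val m)).
Proof.
apply: dirD_near.
set z := chart _ m; set s := chart_at m.
have : (chart s @` (chart_dom s `&` (chart_dom s : set (open_part oO)))) z.
  by exists m => //; split; exact: mem_chart_at.
move=> /(line_near v (@chart_open _ _ (open_part oO) s s)).
apply: filterS => t [y [sy _] <-] /=.
have -> : chart_inv m (chart s y) = y by exact: chartK.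
by have -> : chart_inv (val m) (chart s y) = val y by exact: chartK.
Qed.

End NaturalTopology.

(** * Christoffel symbols of a linear connection *)

Section LinearConnection.
Context {R : realType} {E : convenientType R} {M : manifold E}
  {F : convenientType R} (B : vector_bundle M F).

(* [K m v] is the Christoffel term at m in the selected chart, [G i k] the
   Christoffel symbol over the chart i and the trivialization k: the vertical
   part [w + K m v] of (v, w) transforms linearly. *)
Lemma linear_connection_christoffel H : @linear_connection R E M F B H ->
  exists (K : total_manifold B -> E -> F)
    (G : chart_ix M -> triv_ix B -> E -> E -> F -> F),
  [/\ forall m, linear (K m),
      forall i k, smooth_along
        [set q : E * E * F | (chart i @` (chart_dom i `&` triv_dom k)) q.1.1]
        id (fun q => G i k q.1.1 q.1.2 q.2) &
      forall (m : total_manifold B) i k v w,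
        over (chart_dom i `&` triv_dom k) m ->
        triv ((i, k) : triv_ix (tangent (total_manifold B)))
          ((v, w) : tangent (total_manifold B) m) =
        (triv (i : triv_ix (tangent M)) (v : tangent M (projT1 m)),
         triv k (triv_inv (triv_at (projT1 m)) (projT1 m) (w + K m v)) -
         G i k (chart i (projT1 m))
           (triv (i : triv_ix (tangent M)) (v : tangent M (projT1 m)))
           (triv k (projT2 m)))].
Proof.
move=> [_ HP].
have [G0 GP] := choice (fun ik : chart_ix M * triv_ix B => HP ik.1 ik.2).
pose G i k := G0 (i, k).
pose K (m : total_manifold B) v := let x := projT1 m in
  G (chart_at x) (triv_at x) (chart (chart_at x) x) v
    (triv (triv_at x) (projT2 m)).
have atP (m : total_manifold B) : let x := projT1 m in
    (chart_dom (chart_at x) `&` triv_dom (triv_at x : triv_ix B)) x.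
  by split; [exact: mem_chart_at|exact: mem_triv_at (vector_bundleP B) _].
exists K, G; split.
- move=> m; set x := projT1 m.
  have [Gb _ _] := GP (chart_at x, triv_at x).
  have [|_ Gl _] := Gb (chart (chart_at x) x); last exact: Gl.
  by exists x => //; exact: atP.
- by move=> i k; have [] := GP (i, k).
move=> m i k v w mik.
(* The selected chart trivializes the tangent space at [m] by the identity, so there the graph of
   [- K m] is [H m] itself. *)
have Hv : H m (v, - K m v).
  have [_ _ /(_ m (atP m)) HE] := GP (chart_at (projT1 m), triv_at (projT1 m)).
  have : (triv (chart_at m : triv_ix (tangent (total_manifold B))) @` H m)
      (v, - K m v).
    by rewrite HE; exists v.
  move=> [u Hu]; rewrite triv_tangent_at => <- //.
(* Since [a] is independent of [w], one vector determines it: [(v, - K m v)] is horizontal, so its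
   image lies on the graph given by [- G i k]. *)
have [a aP] := triv_total_tangent v mik.
have [_ _ /(_ m mik)/seteqP[Himg _]] := GP (i, k).
have [v' _] := Himg _ (ex_intro2 _ _ _ Hv erefl).
rewrite !aP => -[->] ->; congr pair.
set x := projT1 m; have [_ rx] := atP m; have [_ kx] := mik.
(* Put in the shape [a *: u + v] in which linearity is stated. *)
have -> : w + K m v = -1 *: (- K m v) + w by rewrite scaleN1r opprK addrC.
rewrite (triv_inv_linear rx) (triv_linear (vector_bundleP B) kx) scaleN1r.
by rewrite [RHS]addrC -addrA addNKr.
Qed.

End LinearConnection.

(** * The reflection on the fibres of the prolongation *)

Section Prolongation.
Context {R : realType} {E FA F : convenientType R} {M : manifold E}
  {A : vector_bundle M FA} (rho : anchor A) {B : vector_bundle M F}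
  {O : set (total_manifold B)} (oO : mopen O).
Variables (K : total_manifold B -> E -> F).

Lemma prolongP (m : open_part oO) (u : prolong_fibre rho m) :
  rho (open_proj m) (val u).1 = (val u).2.1.
Proof. by have := valP u; rewrite inE /= tangent_open_proj => /eqP. Qed.

(** On the vertical part [w + K m v] this is a change of sign; [a] and [v] are kept, hence so is the
    condition [rho a = v]. *)
Definition reflection_pair (m : open_part oO) (u : prolong_fibre rho m) :
    (A (open_proj m) * tangent (open_part oO) m)%type :=
  ((val u).1, ((val u).2.1, - (val u).2.2 - 2 *: K (val m) (val u).2.1)).

Lemma reflection_subproof m u :
  @reflection_pair m u \in prolong_pred rho (m:=m).
Proof. by rewrite inE /= tangent_open_proj prolongP. Qed.

Definition reflection m (u : prolongation rho oO m) : prolongation rho oO m :=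
  exist _ (@reflection_pair m u) (reflection_subproof u).

Lemma reflection_linear m : linear (K (val m)) -> linear (@reflection m).
Proof.
move=> Kl a u v; apply: val_inj; rewrite /= /reflection_pair /=.
congr (_, (_, _)); rewrite /= Kl.
rewrite scalerDr scalerBr !opprD !scalerN !scalerA [2 * a]mulrC.
by rewrite addrACA.
Qed.

Lemma reflectionK m : involutive (@reflection m).
Proof.
move=> u; apply: val_inj; rewrite /= /reflection_pair /=.
by rewrite opprD !opprK addrK; case: (val u) => a [].
Qed.

(* The vertical part w + K_m(v) of (a, (v, w)), moved from the selected
   trivialization to k. *)
Definition vertical_part (k : triv_ix B) (m : open_part oO)
    (u : prolongation rho oO m) : F :=
  triv k (triv_inv (triv_at (open_proj m)) (open_proj m)
    ((val u).2.2 + K (val m) (val u).2.1) : B (open_proj m)).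

Lemma vertical_part_reflection k m (u : prolongation rho oO m) :
  triv_dom k (open_proj m) ->
  vertical_part k (reflection u) = - vertical_part k u.
Proof.
move=> kx; have rx := mem_triv_at (vector_bundleP B) (open_proj m).
rewrite /vertical_part /= /reflection_pair /=; set w := (val u).2.2.
set c := K _ _.
have -> : - w - 2 *: c + c = -1 *: (w + c) + 0.
  by rewrite addr0 scaleN1r scaler_nat mulr2n !opprD addrA subrK.
rewrite (triv_inv_linear rx) (triv_linear (vector_bundleP B) kx) scaleN1r.
have -> : triv_inv (triv_at (open_proj m)) (open_proj m) 0 = 0 :> B _.
  by apply/(triv_eq0 rx); rewrite triv_invK.
by rewrite (triv0 kx) addr0.
Qed.

Lemma vertical_part_eq0 k m (u : prolongation rho oO m) :
  triv_dom k (open_proj m) ->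
  vertical_part k u = 0 <-> (val u).2.2 + K (val m) (val u).2.1 = 0.
Proof.
move=> kx; have rx := mem_triv_at (vector_bundleP B) (open_proj m).
rewrite /vertical_part (triv_eq0 kx) -(triv_eq0 rx) triv_invK//.
Qed.

(** The only component of the difference that can be nonzero is [2 *: (w + K m v)], and 2 is
    invertible. *)
Lemma reflection_fixed m (u : prolongation rho oO m) :
  u - reflection u = 0 <-> (val u).2.2 + K (val m) (val u).2.1 = 0.
Proof.
set w := (val u).2.2; set c := K _ _.
have E2 : (val (u - reflection u)).2.2 = 2 *: (w + c).
  by rewrite /= -/w opprB opprK addrA addrAC -mulr2n -scaler_nat scalerDr.
split=> [u0|wc0].
  move: E2; rewrite u0 /= => /esym/eqP; rewrite scaler_eq0 pnatr_eq0 /=.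
  by move/eqP.
apply: val_inj; apply/eqP; rewrite -[_ == _]/[&& _ == _, _ == _ & _ == _].
rewrite E2 wc0 scaler0 /=.
by rewrite !subrr !eqxx.
Qed.

(** If [a = 0] then [v = rho a = 0], so [K m v = 0] and [w] cancels. Conversely, the component of
    the sum in [A] is [2 *: a]. *)
Lemma reflection_antifixed m (u : prolongation rho oO m) : linear (K (val m)) ->
  vertical_prolongation u <-> u + reflection u = 0.
Proof.
move=> Kl; rewrite /vertical_prolongation /=; split=> [a0|].
  have v0 : (val u).2.1 = 0 by rewrite -prolongP a0 linear0.
  have K0 : K (val m) 0 = 0.
    by have := Kl (-1) 0 0; rewrite scaler0 addr0 scaleN1r addNr.
  apply: val_inj; apply/eqP; rewrite -[_ == _]/[&& _ == _, _ == _ & _ == _] /=.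
  by rewrite a0 v0 K0 scaler0 subr0 subrr !addr0 !eqxx.
move=> /(congr1 (fun b => (val b).1)) /= /eqP.
by rewrite -mulr2n -scaler_nat scaler_eq0 pnatr_eq0 /= => /eqP.
Qed.

End Prolongation.

(** * Smoothness of the reflection and the Whitney decomposition *)

Section Connection.
Context {R : realType} {E FA F : convenientType R} {M : manifold E}
  {A : vector_bundle M FA} (rho : anchor A) {B : vector_bundle M F}
  {O : set (total_manifold B)} (oO : mopen O).
Variables (K : total_manifold B -> E -> F)
  (G : chart_ix M -> triv_ix B -> E -> E -> F -> F).
Hypothesis Klin : forall m, linear (K m).
Hypothesis Gsmooth : forall i k, smooth_along
  [set q : E * E * F | (chart i @` (chart_dom i `&` triv_dom k)) q.1.1]
  id (fun q => G i k q.1.1 q.1.2 q.2).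
Hypothesis KG : forall (m : total_manifold B) i k v w,
  over (chart_dom i `&` triv_dom k) m ->
  triv ((i, k) : triv_ix (tangent (total_manifold B)))
    ((v, w) : tangent (total_manifold B) m) =
  (triv (i : triv_ix (tangent M)) (v : tangent M (projT1 m)),
   triv k (triv_inv (triv_at (projT1 m)) (projT1 m) (w + K m v)) -
   G i k (chart i (projT1 m))
     (triv (i : triv_ix (tangent M)) (v : tangent M (projT1 m)))
     (triv k (projT2 m))).

Let MM := open_part oO.
Let P := prolongation rho oO.

Let anchored (m : MM) (u : P m) : A (open_proj m) :=
  (val (u : prolong_fibre rho m)).1.

(** The velocity is written [rho a] instead of the equal base part of [mu]: the term then depends
    only on the point and [a], and smoothness of the anchor applies to it. *)
Definition christoffel_term (j : chart_ix M) (k : triv_ix B)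
    (u : total P) : F :=
  let m : MM := projT1 u in let x := open_proj m in
  G j k (chart j x)
    (triv (j : triv_ix (tangent M)) (rho x (anchored (projT2 u))))
    (triv k (projT2 (val m))).

(** This is [KG] carried over to the open part, with the base part of [mu] replaced by [rho a]. *)
Lemma triv_prolongation j k l (m : MM) (u : P m) :
  chart_dom j (open_proj m) -> triv_dom k (open_proj m) ->
  triv (((j, k), l) : triv_ix P) u =
  (triv l (anchored u),
   vertical_part K k u - christoffel_term j k (existT _ m u)).
Proof.
move=> jx kx; rewrite /=; congr (_, _).
have := triv_tangent_open_part (m : MM) ((j, k) : chart_ix (total_manifold B))
  (val (u : prolong_fibre rho m)).2.
rewrite /= => ->; rewrite [X in dirD _ _ X](surjective_pairing _).
have := @KG (val m) j k (val (u : prolong_fibre rho m)).2.1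
  (val (u : prolong_fibre rho m)).2.2 (conj jx kx).
by rewrite /= => ->; rewrite /christoffel_term prolongP.
Qed.

(** The anchor is smooth from base coordinates in [i] to tangent coordinates in [j], so the base
    curve is first moved from [i] to [j]. *)
Lemma smooth_christoffel_term i j k l (g : R -> total P) :
  smooth_along (over (chart_dom i `&` triv_dom l `&` chart_dom j))
    (total_coord i l) (fun b : total A =>
      triv (j : triv_ix (tangent M)) (rho _ (projT2 b))) ->
  (forall t, let x := open_proj (projT1 (g t)) in
    [/\ chart_dom i x, chart_dom j x, triv_dom k x & triv_dom l x]) ->
  smooth_curve (fun t => @chart _ _ MM (i, k) (projT1 (g t))) ->
  smooth_curve (fun t => triv l (anchored (projT2 (g t)))) ->
  smooth_curve (christoffel_term j k \o g).
Proof.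
move=> rs gP sm sa.
pose x t := open_proj (projT1 (g t)).
have sxi := smooth_fst sm; have se := smooth_snd sm.
have sxj : smooth_curve (fun t => chart j (x t)).
  apply: (@chart_change _ _ M i j x) sxi => t.
  by have [? ? _ _] := gP t.
pose a t : total A := existT _ (x t) (anchored (projT2 (g t))).
have sv := rs a _ (smooth_pair sxi sa).
apply: (@Gsmooth j k (fun t =>
  (chart j (x t), triv (j : triv_ix (tangent M)) (rho _ (projT2 (a t))),
   triv k (projT2 (val (projT1 (g t))))))).
  by move=> t; have [? ? ? ?] := gP t; exists (x t).
apply: smooth_pair se; apply: smooth_pair => //; apply: sv => t.
by have [? ? ? ?] := gP t.
Qed.

(** Coordinates adapted to the decomposition: they differ from the trivialization of the
    prolongation by the Christoffel term. *)
Definition prolongation_splitting (l : triv_ix A) (k : triv_ix B) (m : MM)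
    (u : P m) : FA * F :=
  (triv l (anchored u), vertical_part K k u).

Lemma prolongation_splitting_linear l k m :
  triv_dom l (open_proj m) -> triv_dom k (open_proj m) ->
  linear (@prolongation_splitting l k m).
Proof.
move=> lx kx a u v; rewrite /prolongation_splitting /vertical_part /=.
have rx := mem_triv_at (vector_bundleP B) (open_proj m).
congr (_, _); first exact: (triv_linear (vector_bundleP A) lx).
rewrite /= Klin addrACA -scalerDr (triv_inv_linear rx).
exact: (triv_linear (vector_bundleP B) kx).
Qed.

Lemma prolongation_splitting_bij l k m :
  triv_dom l (open_proj m) -> triv_dom k (open_proj m) ->
  bijective (@prolongation_splitting l k m).
Proof.
move=> lx kx; set x := open_proj m.
have rx := mem_triv_at (vector_bundleP B) x.
(* The inverse: [a] comes from the first coordinate, [rho a] is then the forced base part of [mu],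
   and subtracting [K] undoes the shift in [vertical_part]. *)
pose h (q : FA * F) : A x * tangent MM m :=
  let v := rho x (triv_inv l x q.1) in
  (triv_inv l x q.1, (v, triv (triv_at x) (triv_inv k x q.2) - K (val m) v)).
have hP q : h q \in prolong_pred rho (m:=m).
  by rewrite inE /= tangent_open_proj eqxx.
exists (fun q => exist _ (h q) (hP q) : P m).
  move=> u; apply: val_inj; rewrite /= /h /prolongation_splitting /=.
  rewrite /vertical_part trivK// !(trivK kx) triv_invK// prolongP addrK.
  by case: u => -[? []].
move=> [p q]; rewrite /prolongation_splitting /vertical_part /= triv_invK//.
by rewrite subrK (trivK rx) triv_invK.
Qed.

Lemma smooth_reflection : smooth_hom (@reflection _ _ _ _ _ _ rho _ _ oO K).
Proof.
move=> m0; have [i [l [j [ix lx jx rs]]]] := anchor_smooth rho (open_proj m0).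
set k : triv_ix B := triv_at (open_proj m0).
have kx : triv_dom k (open_proj m0) := mem_triv_at (vector_bundleP B) _.
exists ((i, k) : chart_ix MM), (((j, k), l) : triv_ix P).
exists (((j, k), l) : triv_ix P).
split=> // g gP sg.
have gD t : let x := open_proj (projT1 (g t)) in
    [/\ chart_dom i x, chart_dom j x, triv_dom k x & triv_dom l x].
  by have [[[? ?] [[? ?] ?]] _] := gP t.
have sm := smooth_fst sg; have st := smooth_snd sg.
have sa := smooth_fst st.
have sG := smooth_christoffel_term rs gD sm sa.
(* The fibre coordinate of the image is [- w - 2 *: G], with [w] and the Christoffel term [G] both
   read in the fixed chart. *)
have := smooth_curveD (smooth_curveZ (-1) (smooth_snd st))
  (smooth_curveZ (-2) sG).
move=> /(smooth_pair sa); congr smooth_curve; apply/funext => t.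
have [_ jt kt _] := gD t.
rewrite /=; case: (g t) jt kt => m u jt kt.
have T u' := @triv_prolongation j k l m u' jt kt.
rewrite [RHS](_ : _ = triv (((j, k), l) : triv_ix P) (reflection K u))//.
rewrite [LHS](_ : _ = ((triv (((j, k), l) : triv_ix P) u).1,
  -1 *: (triv (((j, k), l) : triv_ix P) u).2 +
  -2 *: christoffel_term j k (existT _ m u)))//.
rewrite !T vertical_part_reflection//; congr (_, _) => /=.
(* The reflection keeps the point and [a], hence also the Christoffel term. *)
rewrite [X in _ = _ - X](_ : _ = christoffel_term j k (existT _ m u))//.
rewrite scaleN1r opprB addrC scaleNr scaler_nat mulr2n opprD addrA.
by rewrite subrK addrC.
Qed.

Lemma reflection_whitney_sum : whitney_sum
  (fun m => [set u : P m | u - reflection K u = 0])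
  (@vertical_prolongation _ _ _ _ _ _ rho _ _ oO).
Proof.
exists FA, F => m0.
have [i [l [j [ix lx jx rs]]]] := anchor_smooth rho (open_proj m0).
set k : triv_ix B := triv_at (open_proj m0).
have kx : triv_dom k (open_proj m0) := mem_triv_at (vector_bundleP B) _.
(* The anchor is smooth in [i], [l] and [j] near the base point; [k] is the trivialization selected
   there. *)
pose D := chart_dom i `&` (chart_dom j `&` (triv_dom k `&` triv_dom l)) : set M.
pose U := @open_proj _ _ _ _ _ _ oO @^-1` D.
have gD (g : R -> total P) S : (forall t, over (U `&` S) (g t)) ->
    forall t, let x := open_proj (projT1 (g t)) in
    [/\ chart_dom i x, chart_dom j x, triv_dom k x & triv_dom l x].
  by move=> gP t; have [[? [? []]]] := gP t.
exists U, (@prolongation_splitting l k); split=> //.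
- split.
  + apply: (@mopen_val _ _ _ _ _ (@bundle_proj _ _ _ _ B @^-1` D)).
    apply: mopen_bundle_proj.
    apply: mopenI; first exact: mopen_chart_dom.
    apply: mopenI; first exact: mopen_chart_dom.
    apply: mopenI; exact: triv_dom_open (vector_bundleP _) _.
  + move=> m [_ [_ [km lm]]].
    split; first exact: prolongation_splitting_linear.
    exact: prolongation_splitting_bij.
  + move=> m [im [jm [km lm]]].
    exists ((i, k) : chart_ix MM), (((j, k), l) : triv_ix P); split=> //.
    (* Adding the Christoffel term passes to the adapted coordinates. *)
    * move=> g gP sg; rewrite -setIA in gP.
      have gd := gD _ _ gP.
      have sm := smooth_fst sg; have st := smooth_snd sg.
      have sa := smooth_fst st.
      have sG := smooth_christoffel_term rs gd sm sa.
      have := smooth_pair sa (smooth_curveD (smooth_snd st) sG).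
      congr smooth_curve; apply/funext => t; have [_ jt kt _] := gd t.
      rewrite /=; case: (g t) jt kt => m' u jt kt.
      rewrite [LHS](_ : _ = ((triv (((j, k), l) : triv_ix P) u).1,
        (triv (((j, k), l) : triv_ix P) u).2 +
        christoffel_term j k (existT _ m' u)))//.
      by rewrite triv_prolongation//= subrK.
    (* Subtracting it goes back: its arguments, the point and [a], are also visible in the adapted
       coordinates. *)
    * move=> g gP sg; rewrite -setIA in gP.
      have gd := gD _ _ gP.
      have sm := smooth_fst sg; have st := smooth_snd sg.
      have sa := smooth_fst st.
      have sG := smooth_christoffel_term rs gd sm sa.
      have := smooth_pair sa
        (smooth_curveD (smooth_snd st) (smooth_curveZ (-1) sG)).
      congr smooth_curve; apply/funext => t; have [_ jt kt _] := gd t.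
      rewrite /=; case: (g t) jt kt => m' u jt kt.
      rewrite [RHS](_ : _ = triv (((j, k), l) : triv_ix P) u)//.
      by rewrite triv_prolongation//= scaleN1r.
- move=> m [_ [_ [km lm]]] u; split.
    by rewrite vertical_part_eq0// -reflection_fixed.
  by rewrite /prolongation_splitting (triv_eq0 lm).
Qed.

End Connection.

Theorem theorem36 (R : realType) (MM AA EE : convenientType R)
  (M : manifold MM) (A : vector_bundle M AA) (rho : anchor A)
  (E : vector_bundle M EE)
  (O : set (total_manifold E)) (oO : mopen O)
  (fibO : surjective_fibration A O)
  (linE : exists H, @linear_connection R MM M EE E H) :
  exists N : forall m : open_part oO,
      {linear prolongation rho oO m -> prolongation rho oO m},
    connection (@vertical_prolongation R MM M AA EE A rho E O oO) N.
Proof.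
have [H /linear_connection_christoffel[K [G [Kl Gs KG]]]] := linE.
pose N m : {linear prolongation rho oO m -> prolongation rho oO m} :=
  HB.pack (@reflection _ _ _ _ _ _ rho _ _ oO K m)
    (GRing.isLinear.Build _ _ _ _ _ (reflection_linear (Kl (val m)))).
exists N; split.
- exact: smooth_reflection Gs KG.
- by move=> m; exact: reflectionK.
- by move=> m u; exact: reflection_antifixed.
- exact: reflection_whitney_sum Kl Gs KG.
Qed.
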